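(* Let $d,n_S\ge 1$, $\sigma>0$, $r>0$, and let $X_S\in\mathbb{R}^{n_S\times d}$ be a fixed matrix such that $\hat\Sigma_S:=X_S^\top X_S/n_S$ is invertible. Observations are $\mathbf{y}_S=X_S\boldsymbol{\beta}^*+\mathbf{z}$ with $\mathbf{z}\sim\mathcal{N}(0,\sigma^2 I_{n_S})$ and unknown $\boldsymbol{\beta}^*\in\mathcal{B}:=\{\boldsymbol{\beta}\in\mathbb{R}^d:\|\boldsymbol{\beta}\|_2\le r\}$. Let $\Sigma_T\in\mathbb{R}^{d\times d}$ be positive definite, and suppose there is an orthogonal matrix $U$ and vectors $\mathbf{t},\mathbf{s}\in(0,\infty)^d$ with $\Sigma_T=U\operatorname{diag}(\mathbf{t})U^\top$ and $\hat\Sigma_S=U\operatorname{diag}(\mathbf{s})U^\top$. Define the minimax linear risk $$R_L(\mathcal{B}):=\min_{A\in\mathbb{R}^{d\times n_S}}\ \max_{\boldsymbol{\beta}^*\in\mathcal{B}}\ \mathbb{E}_{\mathbf{z}}\big\|\Sigma_T^{1/2}(A\mathbf{y}_S-\boldsymbol{\beta}^* )\big\|_2^2 .$$ Let $\lambda=\lambda(r)>0$ be determined by $\frac{\sigma^2}{n_S}\sum_{i=1}^d \frac{1}{s_i}\big(\sqrt{t_i}/\lambda-1\big)_+=r^2$. Then $$R_L(\mathcal{B})=\sum_{i=1}^d\frac{\sigma^2}{n_S}\frac{t_i}{s_i}\Big(1-\frac{\lambda}{\sqrt{t_i}}\Big)_+ ,$$ and this value is attained by the linear estimator $$\hat{\boldsymbol{\beta}}_{\mathrm{MM}}=\Sigma_T^{-1/2}U\big(I-\operatorname{diag}(\lambda/\sqrt{\mathbf{t}})\big)_+U^\top\Sigma_T^{1/2}\,\hat{\boldsymbol{\beta}}_{\mathrm{SS}},\qquad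 \hat{\boldsymbol{\beta}}_{\mathrm{SS}}:=\frac{1}{n_S}\hat\Sigma_S^{-1}X_S^\top\mathbf{y}_S,$$ where $\operatorname{diag}(\lambda/\sqrt{\mathbf{t}})$ is the diagonal matrix with entries $\lambda/\sqrt{t_i}$ and $(\cdot)_+$ is applied entrywise to the diagonal.
   Context: $(x)_+=\max(x,0)$. An estimator is called linear if it has the form $\mathbf{y}_S\mapsto A\mathbf{y}_S$ for a matrix $A$ that may depend on $X_S$, $n_S$, $\Sigma_T$ but not on $\mathbf{y}_S$. The expectation is over the noise $\mathbf{z}$ only; $X_S$ is treated as fixed. *)

(* Defs.v *)
From HB Require Import structures.
From mathcomp Require Import all_boot all_order all_algebra.
From mathcomp Require Import all_classical all_reals all_analysis.
Set Implicit Arguments. Unset Strict Implicit. Unset Printing Implicit Defensive.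
Import Order.TTheory GRing.Theory Num.Theory.
Local Open Scope ring_scope.

Section Defs.
Context {R : realType}.

Definition pos (x : R) : R := Num.max x 0.

Definition sumsq {n} (v : 'cV[R]_n) : R := \sum_(i < n) v i 0 ^+ 2.
Definition l2norm {n} (v : 'cV[R]_n) : R := Num.sqrt (sumsq v).

(* Expectation of f(z) for z ~ N(0, sigma^2 I_n), written as the iterated
   integral over the n independent N(0, sigma^2) coordinates
   (normal_prob m s has mean m and standard deviation s). *)
Fixpoint gauss_expect (sigma : R) (n : nat) : ('cV[R]_n -> \bar R) -> \bar R :=
  match n with
  | 0 => fun f => f 0
  | m.+1 => fun f =>
      (\int[normal_prob 0 sigma]_x
          gauss_expect sigma (fun z : 'cV[R]_m => f (col_mx (x%:M : 'M[R]_1) z)))%E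
  end.

Definition lin_risk {d n} (sigma : R) (XS : 'M[R]_(n, d)) (ST12 : 'M[R]_d)
  (A : 'M[R]_(d, n)) (beta : 'cV[R]_d) : \bar R :=
  gauss_expect sigma
    (fun z : 'cV[R]_n => ((l2norm (ST12 *m (A *m (XS *m beta + z) - beta))) ^+ 2)%:E).

Definition max_risk {d n} (sigma r : R) (XS : 'M[R]_(n, d)) (ST12 : 'M[R]_d)
  (A : 'M[R]_(d, n)) : \bar R :=
  ereal_sup [set lin_risk sigma XS ST12 A b | b in [set b : 'cV[R]_d | l2norm b <= r]].

End Defs.

(* Main.v *)
Require Import Defs.
From HB Require Import structures.
From mathcomp Require Import all_boot all_order all_algebra.
From mathcomp Require Import all_classical all_reals all_analysis.
From mathcomp Require Import measurable_realfun ring lra.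
Import Order.TTheory GRing.Theory Num.Theory.
Import numFieldNormedType.Exports.
Local Open Scope ring_scope.

(** In the common eigenbasis, with [e_i = sqrt t_i] and [G = diag e U^T A], the
    risk of [A] at [beta = U theta] is the squared bias
    [|(G X U - diag e) theta|^2] plus the variance [sigma^2 |G|_F^2].
    For the lower bound it is enough to test the [d] points [r u_i], where [u_i]
    is the [i]-th column of [U], averaged with weights [tau_i^2 / r^2], where
    [tau_i^2 = sigma^2 / (n s_i) (e_i / lambda - 1)_+]; these sum to one by the
    choice of [lambda].  The columns of [X U] are orthogonal, so Bessel's
    inequality bounds the variance below in terms of the diagonal entries [w_i]
    of [G X U] alone, and the problem splits into [d] scalar quadratic
    minimizations, solved by [w_i = (e_i - lambda)_+].  The stated estimator
    realizes these [w_i]; each of its bias coefficients is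
    [min(e_i, lambda) <= lambda], which gives the matching upper bound. *)

(** * Gaussian integrals of quadratic polynomials *)

Section NormalMoments.
Set Implicit Arguments.
Unset Strict Implicit.
Local Open Scope classical_set_scope.
Context {R : realType}.
Notation mu := (@lebesgue_measure R).
Implicit Types s x : R.

(** The Radon-Nikodym derivative equals [normal_pdf] almost everywhere, since both have the same
    integral over every measurable set. *)
Lemma ge0_integral_normal_prob (m s : R) (f : R -> \bar R) :
  (forall x, 0 <= f x)%E -> measurable_fun [set: R] f ->
  (\int[normal_prob m s]_x f x = \int[mu]_x (f x * (normal_pdf m s x)%:E))%E.
Proof.
move=> f0 mf; have dom := @normal_prob_dominates R m s.
rewrite -(Radon_Nikodym_SigmaFinite.change_of_variables dom)//.
have intRN := Radon_Nikodym_SigmaFinite.f_integrable dom.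
apply: ae_eq_integral => //.
- by apply: emeasurable_funM => //; exact: measurable_int intRN.
- apply: emeasurable_funM => //; apply/measurable_EFinP.
  exact: measurable_normal_pdf.
- apply: ae_eqe_mul2l; apply: integral_ae_eq => //=.
  + by apply/measurable_EFinP; exact: measurable_normal_pdf.
  + by move=> E _ mE; rewrite -Radon_Nikodym_SigmaFinite.f_integral.
Qed.

(** Reflecting the negative half line pairs [x] with [- x], so that odd terms can cancel
    pointwise. *)
Lemma ge0_integralT_fold (f : R -> R) : (forall x, 0 <= f x) -> continuous f ->
  (\int[mu]_x (f x)%:E = \int[mu]_(x in `[0%R, +oo[) (f x + f (- x))%:E)%E.
Proof.
move=> f0 cf.
have mf : measurable_fun [set: R] f by exact: continuous_measurable_fun.
have mfN : measurable_fun [set: R] (f \o -%R) by exact: measurableT_comp.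
under [RHS]eq_integral do rewrite EFinD.
rewrite [RHS]ge0_integralD//=; first last.
- exact/measurable_EFinP/measurable_funTS.
- by move=> x _; rewrite lee_fin.
- exact/measurable_EFinP/measurable_funTS.
- by move=> x _; rewrite lee_fin.
rewrite -(setUv (`[0%R, +oo[ : set R)) ge0_integral_setU//=; first last.
- exact/disj_setPCl.
- by move=> x _; rewrite lee_fin.
- by apply/measurable_EFinP; rewrite setUv.
- exact: measurableC.
congr (_ + _)%E; rewrite setCitvr.
rewrite integral_itv_bndo_bndc; last exact/measurable_EFinP/measurable_funTS.
rewrite -{1}oppr0 ge0_integration_by_substitutionNy//.
exact: continuous_subspaceT.
Qed.

Lemma normal_pdf0N s x : s != 0 -> normal_pdf 0 s (- x) = normal_pdf 0 s x.
Proof. by move=> s0; rewrite !normal_pdfE// /normal_fun !subr0 sqrrN. Qed.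

Lemma is_derive_normal_pdf0 s x : s != 0 ->
  is_derive x 1 (normal_pdf 0 s) (- (x / s ^+ 2) * normal_pdf 0 s x).
Proof.
move=> s0; rewrite normal_pdfE//.
have -> : (fun y => normal_peak s * normal_fun 0 s y) =
  (fun y => normal_peak s * expR (- (y ^+ 2 / (s ^+ 2 *+ 2)))).
  by apply/funext => y; rewrite /normal_fun subr0 mulNr.
apply: is_derive_eq.
rewrite /GRing.scale/= /normal_fun subr0 (mulNr (x ^+ 2)); set e := expR _.
by field; rewrite s0.
Qed.

(** Follows from [1 + y <= expR y] at [y = x^2 / (2 s^2)]. It makes the boundary term of the
    integration by parts below vanish at infinity. *)
Lemma mulr_normal_pdf0_le s x : s != 0 -> 0 < x ->
  x * normal_pdf 0 s x <= normal_peak s * (s ^+ 2 *+ 2) / x.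
Proof.
move=> s0 x0; rewrite normal_pdfE// /normal_fun subr0 mulNr expRN.
have s20 : 0 < s ^+ 2 *+ 2 by rewrite pmulrn_lgt0// exprn_even_gt0.
set y := x ^+ 2 / _.
have y0 : 0 < y by rewrite divr_gt0// exprn_gt0.
rewrite mulrCA -!mulrA ler_wpM2l ?normal_peak_ge0//.
have -> : s ^+ 2 *+ 2 / x = x / y.
  by rewrite /y; field; rewrite s0 !gt_eqF.
rewrite ler_wpM2l ?(ltW x0)// lef_pV2 ?posrE ?expR_gt0//.
by have := expR_ge1Dx y; lra.
Qed.

(** Integration by parts on bounded intervals, where [- s^2 * phi] is a primitive of [x * phi x],
    then passage to the limit. *)
Lemma integral0y_sqr_normal_pdf0 s : s != 0 ->
  (\int[mu]_(x in `[0%R, +oo[) (x ^+ 2 * normal_pdf 0 s x)%:E =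
   (s ^+ 2)%:E * \int[mu]_(x in `[0%R, +oo[) (normal_pdf 0 s x)%:E)%E.
Proof.
move=> s0; set phi := normal_pdf 0 s.
have phi0 x : 0 <= phi x by exact: normal_pdf_ge0.
have mphi : measurable_fun [set: R] phi by exact: measurable_normal_pdf.
have cphi : continuous phi by exact: continuous_normal_pdf.
have dphi (x : R) := is_derive_normal_pdf0 x s0.
(* The right end [n.+1] keeps the interval nondegenerate and lets the tail bound, valid for [0 < x],
   apply. *)
have parts n : (\int[mu]_(x in `[0%R, n.+1%:R]) (x ^+ 2 * phi x)%:E =
  (- (s ^+ 2) * (n.+1%:R * phi n.+1%:R))%:E +
  (s ^+ 2)%:E * \int[mu]_(x in `[0%R, n.+1%:R]) (phi x)%:E)%E.
  pose G x := - (s ^+ 2) * phi x.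
  have dG (x : R) : is_derive x 1 G (x * phi x).
    apply: is_derive_eq; rewrite /GRing.scale/= -/phi; field.
    by rewrite s0.
  have cG : continuous G.
    by move=> x; apply: cvgMr; exact: cphi.
  under eq_integral do rewrite expr2 -mulrA.
  rewrite (@integration_by_parts _ id G (cst 1) (fun x => x * phi x))//.
  - rewrite mul0r subr0; congr (_ + _)%E.
      by rewrite /G; congr EFin; rewrite mulrCA.
    under eq_integral do rewrite mul1r /G EFinM.
    rewrite integralZl//; last first.
      apply: continuous_compact_integrable; first exact: segment_compact.
      exact: continuous_subspaceT.
    by rewrite EFinN mulNe oppeK.
  - by apply: continuous_subspaceT => x; exact: cvg_cst.
  - by split => //; [apply: cvg_at_right_filter|apply: cvg_at_left_filter];
      exact: cvg_id.
  - by move=> x _; rewrite derive1E derive_id.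
  - apply: continuous_subspaceT => x.
    by apply: cvgM; [exact: cvg_id|exact: cphi].
  - by split => //; [apply: cvg_at_right_filter|apply: cvg_at_left_filter];
      exact: cG.
  - by move=> x _; rewrite derive1E derive_val.
have cvgb : (- (s ^+ 2) * (n.+1%:R * phi n.+1%:R))%:E @[n --> \oo] --> 0%E.
  apply: cvg_EFin; first exact: nearW.
  rewrite -[X in _ --> X](mulr0 (- s ^+ 2)); apply: cvgMr.
  pose c := normal_peak s * (s ^+ 2 *+ 2).
  apply: (@squeeze_cvgr _ _ _ _ (cst 0) (fun n => c * n.+1%:R^-1)).
  - apply: nearW => n; rewrite mulr_ge0 ?ler0n//=.
    exact: mulr_normal_pdf0_le.
  - exact: cvg_cst.
  - by rewrite -[X in _ --> X](mulr0 c); apply: cvgMr; exact: cvg_harmonic.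
have m2 : measurable_fun [set: R] (fun x => x ^+ 2 * phi x).
  by apply: measurable_funM => //; exact: measurable_funX.
have cvgl := @ge0_cvgn_integral R mu (fun x => x ^+ 2 * phi x)
  (fun x => mulr_ge0 (sqr_ge0 x) (phi0 x)) m2.
have cvgr := @ge0_cvgn_integral R mu phi phi0 mphi.
(* The index is shifted to match the right end [n.+1]; uniqueness of the limit then identifies the
   two sides. *)
rewrite -cvg_shiftS in cvgl; rewrite -cvg_shiftS in cvgr.
apply: (cvg_unique _ cvgl) => //; rewrite (funext parts).
set I0 := (\int[mu]_(x in `[0%R, +oo[) (phi x)%:E)%E in cvgr *.
by rewrite -[(_ * I0)%E]add0e; apply: cvgeD => //; exact: cvgeZl.
Qed.

(* Folding the integral at the origin cancels the odd term, so only nonnegative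
   integrands occur and no integrability has to be checked. *)
Lemma normal_prob_integral_quadratic s (a b c : R) : s != 0 ->
  0 <= a -> 0 <= c -> (forall x, 0 <= a * x ^+ 2 + b * x + c) ->
  (\int[normal_prob 0 s]_x (a * x ^+ 2 + b * x + c)%:E = (a * s ^+ 2 + c)%:E)%E.
Proof.
move=> s0 a0 c0 q0; set q := fun x => a * x ^+ 2 + b * x + c.
have cq : continuous q.
  move=> x; apply: cvgD; last exact: cvg_cst.
  apply: cvgD; apply: cvgMr; last exact: cvg_id.
  exact: exprn_continuous.
rewrite ge0_integral_normal_prob//; last first.
  by apply/measurable_EFinP; exact: continuous_measurable_fun.
set phi := normal_pdf 0 s.
have phi0 x : 0 <= phi x by exact: normal_pdf_ge0.
have cphi : continuous phi by exact: continuous_normal_pdf.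
have mphi : measurable_fun [set: R] phi by exact: measurable_normal_pdf.
under eq_integral do rewrite -EFinM.
rewrite (ge0_integralT_fold (f := fun x => q x * phi x)); last 2 first.
  by move=> x; exact: (mulr_ge0 (q0 x) (phi0 x)).
  by move=> x; apply: cvgM; [exact: cq|exact: cphi].
have integralZ (k : R) (f : R -> R) : 0 <= k -> (forall x, 0 <= f x) ->
    measurable_fun [set: R] f ->
    (\int[mu]_(x in `[0%R, +oo[) (k * f x)%:E =
     k%:E * \int[mu]_(x in `[0%R, +oo[) (f x)%:E)%E.
  move=> k0 f0 mf; under eq_integral do rewrite EFinM.
  rewrite ge0_integralZl//=; first exact/measurable_EFinP/measurable_funTS.
  by move=> x _; rewrite lee_fin.
(* The half line carries mass one half: the density is even with total integral one. *)
have I1 : (2%:E * \int[mu]_(x in `[0%R, +oo[) (phi x)%:E = 1)%E.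
  rewrite -integralZ//.
  transitivity (\int[mu]_x (phi x)%:E)%E; last exact: integral_normal_pdf.
  rewrite (ge0_integralT_fold phi0 cphi); apply: eq_integral => x _.
  by rewrite /phi normal_pdf0N//; congr EFin; ring.
pose psi x := x ^+ 2 * phi x.
have psi0 x : 0 <= psi x by rewrite mulr_ge0 ?sqr_ge0.
have mpsi : measurable_fun [set: R] psi.
  by apply: measurable_funM => //; exact: measurable_funX.
transitivity (\int[mu]_(x in `[0%R, +oo[)
    ((2 * a * psi x)%:E + (2 * c * phi x)%:E))%E.
  apply: eq_integral => x _; rewrite /psi /phi normal_pdf0N// -EFinD.
  by congr EFin; rewrite /q; ring.
have a20 : 0 <= 2 * a by lra.
have c20 : 0 <= 2 * c by lra.
rewrite ge0_integralD//=; last 4 first.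
  by move=> x _; rewrite lee_fin mulr_ge0.
  by apply/measurable_EFinP/measurable_funTS/measurable_funM.
  by move=> x _; rewrite lee_fin mulr_ge0.
  by apply/measurable_EFinP/measurable_funTS/measurable_funM.
rewrite !integralZ// {1}/psi.
rewrite integral0y_sqr_normal_pdf0// -/phi (mulrC 2 a) (mulrC 2 c).
rewrite (EFinM a) (EFinM c).
rewrite -!muleA (muleCA 2%:E) I1 !mule1.
by rewrite -EFinM -EFinD.
Qed.

End NormalMoments.

(** * Sums of squares, the risk in closed form, matrix square roots and Bessel's inequality *)

Section SumSquares.
Set Implicit Arguments.
Unset Strict Implicit.
Context {R : realType}.

Lemma sumsq_ge0 n (v : 'cV[R]_n) : 0 <= sumsq v.
Proof. by apply: sumr_ge0 => i _; rewrite sqr_ge0. Qed.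

Lemma l2norm_sqr n (v : 'cV[R]_n) : l2norm v ^+ 2 = sumsq v.
Proof. by rewrite sqr_sqrtr ?sumsq_ge0. Qed.

Lemma l2norm_le n (v : 'cV[R]_n) (r : R) : 0 <= r ->
  (l2norm v <= r) = (sumsq v <= r ^+ 2).
Proof.
move=> r0; rewrite -(ler_pXn2r (n := 2)) ?nnegrE ?sqrtr_ge0//.
by rewrite l2norm_sqr.
Qed.

Lemma sumsqE n (v : 'cV[R]_n) : sumsq v = (v^T *m v) 0 0.
Proof. by rewrite mxE; apply: eq_bigr => i _; rewrite mxE expr2. Qed.

Lemma sumsq_isometry m n (U : 'M[R]_(m, n)) (v : 'cV[R]_n) :
  U^T *m U = 1%:M -> sumsq (U *m v) = sumsq v.
Proof.
by move=> UU; rewrite !sumsqE trmx_mul mulmxA -(mulmxA v^T) UU mulmx1.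
Qed.

Lemma sumsqZ n (k : R) (v : 'cV[R]_n) : sumsq (k *: v) = k ^+ 2 * sumsq v.
Proof.
by rewrite /sumsq mulr_sumr; apply: eq_bigr => i _; rewrite mxE exprMn.
Qed.

Lemma sumsq_delta n (i : 'I_n) : sumsq (delta_mx i 0 : 'cV[R]_n) = 1.
Proof.
rewrite /sumsq (bigD1 i)//= mxE !eqxx expr1n big1 ?addr0// => j ji.
by rewrite mxE (negbTE ji) expr0n.
Qed.

Lemma sumsq_addZ n (u b : 'cV[R]_n) (x : R) :
  sumsq (u + x *: b) =
  sumsq b * x ^+ 2 + (2 * \sum_i u i 0 * b i 0) * x + sumsq u.
Proof.
rewrite /sumsq mulr_suml mulr_sumr mulr_suml -!big_split/=.
by apply: eq_bigr => i _; rewrite !mxE; ring.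
Qed.

Lemma tr_mul_trmxE m n (B : 'M[R]_(m, n)) :
  \tr (B *m B^T) = \sum_i \sum_j B i j ^+ 2.
Proof.
apply: eq_bigr => i _; rewrite mxE; apply: eq_bigr => j _.
by rewrite mxE expr2.
Qed.

Lemma tr_mul_trmx_ge0 m n (B : 'M[R]_(m, n)) : 0 <= \tr (B *m B^T).
Proof.
by rewrite tr_mul_trmxE; do 2 apply: sumr_ge0 => ? _; exact: sqr_ge0.
Qed.

Lemma tr_mul_trmx_col m (b : 'cV[R]_m) : \tr (b *m b^T) = sumsq b.
Proof. by rewrite tr_mul_trmxE; apply: eq_bigr => i _; rewrite big_ord1. Qed.

(** Induction on [n], splitting off the first column [b] of [B]: the remaining coordinates
    contribute a constant, and the first leaves a quadratic polynomial in [x] whose linear term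
    averages out. *)
Lemma gauss_expect_sumsq (s : R) m n (u : 'cV[R]_m) (B : 'M[R]_(m, n)) :
  s != 0 ->
  gauss_expect s (fun z => (sumsq (u + B *m z))%:E) =
  (sumsq u + s ^+ 2 * \tr (B *m B^T))%:E.
Proof.
move=> s0; elim: n u B => [|n IHn] u B.
  by rewrite /= mulmx0 addr0 (thinmx0 B) mul0mx mxtrace0 mulr0 addr0.
pose b : 'cV[R]_m := lsubmx (B : 'M[R]_(m, 1 + n)).
pose B' : 'M[R]_(m, n) := rsubmx (B : 'M[R]_(m, 1 + n)).
have trB : \tr (B *m B^T) = sumsq b + \tr (B' *m B'^T).
  transitivity (\tr (row_mx b B' *m (row_mx b B')^T)); first by rewrite hsubmxK.
  by rewrite tr_row_mx mul_row_col mxtraceD tr_mul_trmx_col.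
rewrite /= trB.
pose c := sumsq u + s ^+ 2 * \tr (B' *m B'^T).
transitivity (\int[normal_prob 0 s]_x
    (sumsq b * x ^+ 2 + (2 * \sum_i u i 0 * b i 0) * x + c)%:E)%E.
  apply: eq_integral => x _.
  rewrite [X in gauss_expect s X](_ : _ =
    (fun z => (sumsq ((u + x *: b) + B' *m z))%:E)); last first.
    apply/funext => z; rewrite -addrA -mul_mx_scalar -mul_row_col.
    by rewrite hsubmxK.
  by rewrite IHn sumsq_addZ /c addrA.
have t0 : 0 <= s ^+ 2 * \tr (B' *m B'^T).
  by rewrite mulr_ge0 ?sqr_ge0 ?tr_mul_trmx_ge0.
rewrite normal_prob_integral_quadratic ?sumsq_ge0//.
- by congr EFin; rewrite /c; ring.
- by rewrite addr_ge0 ?sumsq_ge0.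
- by move=> x; rewrite /c addrA -sumsq_addZ addr_ge0 ?sumsq_ge0.
Qed.

(** Bias-variance decomposition: the weighted error is [(S *m A *m X - S) *m beta] plus the noise
    [S *m A *m z]. *)
Lemma lin_riskE (s : R) d n (X : 'M[R]_(n, d)) (S : 'M[R]_d)
    (A : 'M[R]_(d, n)) (beta : 'cV[R]_d) : s != 0 ->
  lin_risk s X S A beta =
  (sumsq ((S *m A *m X - S) *m beta)
   + s ^+ 2 * \tr ((S *m A) *m (S *m A)^T))%:E.
Proof.
move=> s0; rewrite -gauss_expect_sumsq//; congr gauss_expect.
apply/funext => z; rewrite l2norm_sqr; congr (sumsq _)%:E.
by rewrite mulmxBr mulmxBl !mulmxDr !mulmxA addrAC.
Qed.

(* [V] commutes with [V^2 = diag t], hence with [E = diag (sqrt t)], so that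
   [(V - E)(V + E) = 0] with [V + E] positive definite. *)
Lemma psd_sqrt_diag_mx d (V : 'M[R]_d) (t : 'rV[R]_d) :
  (forall i, 0 < t 0 i) -> (forall x : 'cV[R]_d, 0 <= (x^T *m V *m x) 0 0) ->
  V *m V = diag_mx t -> V = diag_mx (\row_i Num.sqrt (t 0 i)).
Proof.
move=> t0 V0 VV; set e := \row_i _; set E := diag_mx e.
have e0 i : 0 < e 0 i by rewrite mxE sqrtr_gt0.
have e2 i : e 0 i ^+ 2 = t 0 i by rewrite mxE sqr_sqrtr// ltW.
have EE : E *m E = diag_mx t.
  by rewrite mulmx_diag; congr diag_mx; apply/rowP => i; rewrite mxE -expr2.
(* Entrywise, commuting with [diag_mx t] forces [e_i^2 = e_j^2], hence [e_i = e_j], wherever [V i j]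
   is nonzero. *)
have comm : V *m E = E *m V.
  apply/matrixP => i j; rewrite mul_mx_diag mul_diag_mx mxE [RHS]mxE.
  have /matrixP/(_ i j) : V *m diag_mx t = diag_mx t *m V by rewrite -VV mulmxA.
  rewrite mul_mx_diag mul_diag_mx mxE [X in _ = X]mxE -!e2.
  have [->|nz] := eqVneq (V i j) 0; first by move=> _; rewrite mulr0 mul0r.
  rewrite mulrC => /(mulIf nz)/eqP; rewrite eqrXn2 ?(ltW (e0 _))// => /eqP->.
  by rewrite mulrC.
(* A kernel vector [v] makes the forms of [V] and [E] at [v] sum to zero; both are nonnegative, and
   the positive weights of [E] force [v = 0]. *)
have unitVE : V + E \in unitmx.
  rewrite -row_free_unit; apply: inj_row_free => v vVE.
  have : (v *m (V + E) *m v^T) 0 0 = 0 by rewrite vVE mul0mx mxE.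
  rewrite mulmxDr mulmxDl mxE => /eqP.
  have vEv : (v *m E *m v^T) 0 0 = \sum_i e 0 i * v 0 i ^+ 2.
    rewrite mxE; apply: eq_bigr => i _.
    by rewrite mul_mx_diag [X in X * _]mxE [v^T _ _]mxE; ring.
  have vEv0 i : 0 <= e 0 i * v 0 i ^+ 2 by rewrite mulr_ge0 ?sqr_ge0// ltW.
  have := V0 v^T; rewrite trmxK => Vv.
  rewrite paddr_eq0// ?vEv ?sumr_ge0// => /andP[_].
  rewrite psumr_eq0// => /allP /= ev; apply/rowP => i.
  have := ev i (mem_index_enum i); rewrite mulf_eq0 gt_eqF//= sqrf_eq0.
  by move=> /eqP ->; rewrite mxE.
apply/eqP; rewrite -subr_eq0; apply/eqP.
rewrite -[LHS](mulmxK unitVE) mulmxBl !mulmxDr VV EE comm.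
by rewrite (addrC (diag_mx t)) subrr mul0mx.
Qed.

(** With [P] the orthogonal projection onto the columns of [Y], the left side is the trace of
    [G *m P *m G^T], and the gap is the squared Frobenius norm of [G - G *m P]. *)
Lemma bessel_mx m n d (G : 'M[R]_(m, n)) (Y : 'M[R]_(n, d)) (c : 'rV[R]_d) :
  (forall i, 0 < c 0 i) -> Y^T *m Y = diag_mx c ->
  \sum_j \sum_i (G *m Y) j i ^+ 2 / c 0 i <= \tr (G *m G^T).
Proof.
move=> c0 YY; pose C := diag_mx (\row_i (c 0 i)^-1).
have CK : C *m diag_mx c = 1%:M.
  apply/matrixP => i j; rewrite mul_diag_mx !mxE mulrnAr.
  by have [->|] := eqVneq i j; rewrite ?mulr0n// mulVf ?gt_eqF.
(* [P] is the orthogonal projection onto the column space of [Y]. *)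
pose P := Y *m C *m Y^T.
have PT : P^T = P by rewrite /P !trmx_mul trmxK tr_diag_mx mulmxA.
have PP : P *m P = P.
  by rewrite /P -!mulmxA (mulmxA Y^T) YY (mulmxA C (diag_mx c)) CK mul1mx.
have := tr_mul_trmx_ge0 (G - G *m P).
have -> : (G - G *m P) *m (G - G *m P)^T = G *m G^T - G *m P *m G^T.
  rewrite linearB/= trmx_mul PT !mulmxBl !mulmxBr (mulmxA (G *m P)).
  by rewrite -(mulmxA G P P) PP (mulmxA G P) subrr subr0.
rewrite linearB/= subr_ge0; apply: le_trans.
rewrite le_eqVlt; apply/orP; left; apply/eqP; rewrite /P !mulmxA -(mulmxA _ Y^T).
rewrite -trmx_mul /mxtrace; apply: eq_bigr => j _.
rewrite mxE; apply: eq_bigr => i _; rewrite mul_mx_diag !mxE; ring.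
Qed.

End SumSquares.

(** * The scalar problems and the two minimax bounds *)

Section MinimaxBounds.
Set Implicit Arguments.
Unset Strict Implicit.
Context {R : realType}.

(** The weighted estimator is [U *m G], and the orthogonal factor [U] changes neither the sum of
    squares nor the trace. *)
Lemma lin_risk_rotate (sigma : R) d n (X : 'M[R]_(n, d)) (U : 'M[R]_d)
    (e : 'rV[R]_d) (A : 'M[R]_(d, n)) (beta : 'cV[R]_d) : sigma != 0 ->
  U^T *m U = 1%:M -> U *m U^T = 1%:M ->
  let G := diag_mx e *m U^T *m A in
  lin_risk sigma X (U *m diag_mx e *m U^T) A beta =
  (sumsq ((G *m (X *m U) - diag_mx e) *m (U^T *m beta))
   + sigma ^+ 2 * \tr (G *m G^T))%:E.
Proof.
move=> s0 UtU UUt G; rewrite lin_riskE//.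
have -> : U *m diag_mx e *m U^T *m A = U *m G by rewrite /G !mulmxA.
congr (_ + _ * _)%:E.
  rewrite -[RHS](sumsq_isometry _ UtU); congr sumsq.
  rewrite mulmxA mulmxBr !mulmxBl !mulmxA.
  by congr (_ - _); rewrite -?(mulmxA _ U U^T) ?UUt ?mulmx1.
by rewrite trmx_mul mulmxA mxtrace_mulC !mulmxA UtU mul1mx.
Qed.

Lemma pos_ge0 (x : R) : 0 <= pos x.
Proof. by rewrite /pos le_max lexx orbT. Qed.

(** Both positive parts switch at the threshold [e = lam], so one case split serves the three scalar
    estimates below. *)
Lemma shrink_posP (lam e : R) : 0 < lam -> 0 < e ->
  [/\ e <= lam, pos (1 - lam / e) = 0 & pos (e / lam - 1) = 0] \/
  [/\ lam < e, pos (1 - lam / e) = 1 - lam / e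
    & pos (e / lam - 1) = e / lam - 1].
Proof.
move=> lam0 e0; have [el|le] := leP e lam; [left|right]; split => //.
- by apply/max_idPr; rewrite subr_le0 ler_pdivlMr// mul1r.
- by apply/max_idPr; rewrite subr_le0 ler_pdivrMr// mul1r.
- by apply/max_idPl; rewrite subr_ge0 ler_pdivrMr// mul1r ltW.
- by apply/max_idPl; rewrite subr_ge0 ler_pdivlMr// mul1r ltW.
Qed.

(** Completing the square: above the threshold the gap is [e / lam * (w - (e - lam))^2], zero
    exactly at the shrunk value [w = e - lam]. *)
Lemma scalar_bayes_risk_ge (lam e w : R) : 0 < lam -> 0 < e ->
  e ^+ 2 * pos (1 - lam / e) <= pos (e / lam - 1) * (w - e) ^+ 2 + w ^+ 2.
Proof.
move=> lam0 e0; have [[_ -> ->]|[le -> ->]] := shrink_posP lam0 e0.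
  by rewrite mulr0 mul0r add0r sqr_ge0.
rewrite -subr_ge0.
have -> : (e / lam - 1) * (w - e) ^+ 2 + w ^+ 2 - e ^+ 2 * (1 - lam / e) =
  e / lam * (w - (e - lam)) ^+ 2 by field; rewrite !gt_eqF.
by rewrite mulr_ge0 ?sqr_ge0// divr_ge0// ltW.
Qed.

(** Above the threshold this reads [lam (e - lam) + (e - lam)^2 = e (e - lam)]. Weighted by
    [sigma^2 / s_i] and summed, the first term becomes [lam^2 * r^2], the bound on the squared
    bias. *)
Lemma scalar_minimax_risk (lam e : R) : 0 < lam -> 0 < e ->
  lam ^+ 2 * pos (e / lam - 1) + (pos (1 - lam / e) * e) ^+ 2 =
  e ^+ 2 * pos (1 - lam / e).
Proof.
move=> lam0 e0; have [[_ -> ->]|[_ -> ->]] := shrink_posP lam0 e0.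
  by ring.
by field; rewrite !gt_eqF.
Qed.

Lemma scalar_bias_le (lam e : R) : 0 < lam -> 0 < e ->
  (pos (1 - lam / e) * e - e) ^+ 2 <= lam ^+ 2.
Proof.
move=> lam0 e0; have [[el -> _]|[_ -> _]] := shrink_posP lam0 e0.
  by rewrite mul0r sub0r sqrrN ler_pXn2r ?nnegrE ?(ltW lam0) ?(ltW e0).
by rewrite mulrBl mul1r divfK ?gt_eqF// addrAC subrr sub0r sqrrN.
Qed.

Lemma weighted_risk_le_max_risk (d n : nat) (sigma r : R) (X : 'M[R]_(n, d)) S
    (A : 'M[R]_(d, n)) (w : 'I_d -> R) (b : 'I_d -> 'cV[R]_d) (a : 'I_d -> R) :
  (forall i, 0 <= w i) -> \sum_i w i = 1 ->
  (forall i, l2norm (b i) <= r) ->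
  (forall i, ((a i)%:E <= lin_risk sigma X S A (b i))%E) ->
  ((\sum_i w i * a i)%:E <= max_risk sigma r X S A)%E.
Proof.
move=> w0 w1 br ab.
have am i : ((a i)%:E <= max_risk sigma r X S A)%E.
  apply: (le_trans (ab i)); apply: ereal_sup_ubound.
  by exists (b i) => //; exact: br.
case: (max_risk _ _ _ _ _) am => [m| |] am; last 2 first.
- by rewrite leey.
(* The value [-oo] is excluded: weights summing to one provide an index [i], and the finite [a i]
   lies below the supremum. *)
- have [i _|nod] := pickP (predT : pred 'I_d); first by have := am i.
  by move: w1; rewrite big_pred0// => /esym/eqP; rewrite oner_eq0.
rewrite lee_fin -[leRHS]mul1r -w1 mulr_suml ler_sum// => i _.
by rewrite ler_wpM2l// -lee_fin.
Qed.

(** Here [s] holds the eigenvalues of [X^T *m X] itself, without the factor [1 / n]. *)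
Lemma minimax_lower_bound (d n : nat) (sigma r lam : R) (X : 'M[R]_(n, d))
    (U : 'M[R]_d) (e s : 'rV[R]_d) (A : 'M[R]_(d, n)) :
  sigma != 0 -> 0 < r -> 0 < lam ->
  U^T *m U = 1%:M -> U *m U^T = 1%:M ->
  (forall i, 0 < e 0 i) -> (forall i, 0 < s 0 i) ->
  X^T *m X = U *m diag_mx s *m U^T ->
  \sum_i sigma ^+ 2 / s 0 i * pos (e 0 i / lam - 1) = r ^+ 2 ->
  ((\sum_i sigma ^+ 2 / s 0 i * (e 0 i ^+ 2 * pos (1 - lam / e 0 i)))%:E
   <= max_risk sigma r X (U *m diag_mx e *m U^T) A)%E.
Proof.
move=> sg0 r0 lam0 UtU UUt e0 s0 XX lamr.
set G := diag_mx e *m U^T *m A; set W := G *m (X *m U).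
have r20 : 0 < r ^+ 2 by rewrite exprn_gt0.
pose v i := sigma ^+ 2 / s 0 i.
have v0 i : 0 <= v i by rewrite divr_ge0 ?sqr_ge0// ltW.
pose w i := v i * pos (e 0 i / lam - 1) / r ^+ 2.
have w0 i : 0 <= w i by rewrite divr_ge0 ?(ltW r20)// mulr_ge0 ?pos_ge0.
have w1 : \sum_i w i = 1 by rewrite -mulr_suml lamr divff ?gt_eqF.
(* [K] keeps only the diagonal part of Bessel's lower bound on the variance. *)
pose K := \sum_i v i * W i i ^+ 2.
have YY : (X *m U)^T *m (X *m U) = diag_mx s.
  rewrite trmx_mul !mulmxA -(mulmxA U^T) XX !mulmxA UtU mul1mx.
  by rewrite -mulmxA UtU mulmx1.
have KG : K <= sigma ^+ 2 * \tr (G *m G^T).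
  apply: le_trans (ler_wpM2l (sqr_ge0 _) (bessel_mx G s0 YY)).
  rewrite mulr_sumr; apply: ler_sum => i _; rewrite (bigD1 i)//= mulrDr.
  rewrite -/W /v -mulrA (mulrC _^-1) lerDl mulr_ge0 ?sqr_ge0//.
  by apply: sumr_ge0 => j _; rewrite divr_ge0 ?sqr_ge0// ltW.
apply: le_trans (weighted_risk_le_max_risk
  (b := fun i => r *: (U *m delta_mx i 0))
  (a := fun i => r ^+ 2 * (W i i - e 0 i) ^+ 2 + K) w0 w1 _ _); last 2 first.
- move=> i; rewrite l2norm_le ?(ltW r0)// sumsqZ sumsq_isometry//.
  by rewrite sumsq_delta mulr1.
- move=> i; rewrite lin_risk_rotate// -/G -/W lee_fin lerD//.
  rewrite -!scalemxAr (mulmxA U^T U) UtU mul1mx sumsqZ ler_wpM2l ?(ltW r20)//.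
  (* At the [i]-th test point the bias is a multiple of the [i]-th column of [W - diag_mx e]; only
     its diagonal entry is kept. *)
  rewrite -colE /sumsq (bigD1 i)//= !mxE eqxx mulr1n lerDl.
  by apply: sumr_ge0 => j _; exact: sqr_ge0.
rewrite lee_fin; under [leRHS]eq_bigr do rewrite mulrDr.
rewrite big_split/= -mulr_suml w1 mul1r /K -big_split/=; apply: ler_sum => i _.
have -> : w i * (r ^+ 2 * (W i i - e 0 i) ^+ 2) =
   v i * (pos (e 0 i / lam - 1) * (W i i - e 0 i) ^+ 2).
  by rewrite /w; field; rewrite gt_eqF.
by rewrite -mulrDr; apply: ler_wpM2l (v0 i) _ _ _; exact: scalar_bayes_risk_ge.
Qed.

(** [A] stands for the unshrunk estimator: a left inverse of [X], hence unbiased, with covariance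
    diagonal in the basis [U]. *)
Lemma minimax_upper_bound (d n : nat) (sigma r lam : R) (X : 'M[R]_(n, d))
    (U S : 'M[R]_d) (e s : 'rV[R]_d) (A : 'M[R]_(d, n)) :
  sigma != 0 -> 0 < r -> 0 < lam ->
  U^T *m U = 1%:M -> U *m U^T = 1%:M ->
  (forall i, 0 < e 0 i) -> S = U *m diag_mx e *m U^T ->
  A *m X = 1%:M ->
  U^T *m (A *m A^T) *m U = diag_mx (\row_i (s 0 i)^-1) ->
  \sum_i sigma ^+ 2 / s 0 i * pos (e 0 i / lam - 1) = r ^+ 2 ->
  (max_risk sigma r X S (invmx S *m U
     *m diag_mx (\row_i pos (1 - lam / e 0 i)) *m U^T *m S *m A)%R <=
   (\sum_i sigma ^+ 2 / s 0 i * (e 0 i ^+ 2 * pos (1 - lam / e 0 i)))%:E)%E.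
Proof.
move=> sg0 r0 lam0 UtU UUt e0 SE AX AA lamr.
set C := diag_mx (\row_i pos _).
have Sunit : S \in unitmx.
  suff /mulmx1_unit[] : S *m (U *m diag_mx (\row_i (e 0 i)^-1) *m U^T) = 1%:M.
    by [].
  rewrite SE !mulmxA -(mulmxA _ U^T U) UtU mulmx1 -(mulmxA U) mulmx_diag.
  rewrite [diag_mx _](_ : _ = 1%:M) ?mulmx1// -diag_const_mx; congr diag_mx.
  by apply/rowP => i; rewrite !mxE divff ?gt_eqF.
apply: ge_ereal_sup => _ [b /= br <-]; rewrite {1}SE lin_risk_rotate//.
pose ce := \row_i (pos (1 - lam / e 0 i) * e 0 i).
(* Since [diag_mx e *m U^T = U^T *m S], the factor [invmx S] cancels and only the shrunk weights
   [ce], equal to [(e_i - lam)_+], remain. *)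
have -> : diag_mx e *m U^T *m (invmx S *m U *m C *m U^T *m S *m A) =
    diag_mx ce *m U^T *m A.
  have -> : diag_mx e *m U^T = U^T *m S by rewrite SE !mulmxA UtU mul1mx.
  rewrite !mulmxA mulmxK// UtU mul1mx SE !mulmxA -(mulmxA C U^T U) UtU mulmx1.
  rewrite mulmx_diag; congr (diag_mx _ *m _ *m _).
  by apply/rowP => i; rewrite !mxE.
have -> : diag_mx ce *m U^T *m A *m (X *m U) = diag_mx ce.
  by rewrite mulmxA -(mulmxA _ A) AX mulmx1 -mulmxA UtU mulmx1.
have -> : \tr (diag_mx ce *m U^T *m A *m (diag_mx ce *m U^T *m A)^T) =
    \sum_i ce 0 i ^+ 2 / s 0 i.
  transitivity (\tr (diag_mx ce *m (U^T *m (A *m A^T) *m U) *m diag_mx ce)).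
    by rewrite !trmx_mul trmxK tr_diag_mx !mulmxA.
  rewrite AA mul_diag_mx mul_mx_diag /mxtrace.
  by apply: eq_bigr => i _; rewrite !mxE eqxx mulr1n; ring.
have bias : sumsq ((diag_mx ce - diag_mx e) *m (U^T *m b)) <=
    lam ^+ 2 * r ^+ 2.
  apply: (@le_trans _ _ (lam ^+ 2 * sumsq (U^T *m b))); last first.
    rewrite sumsq_isometry ?trmxK// ler_wpM2l ?sqr_ge0//.
    by rewrite -l2norm_le// ltW.
  rewrite -linearB/= mul_diag_mx mulr_sumr; apply: ler_sum => i _.
  rewrite mxE exprMn ler_wpM2r ?sqr_ge0// !mxE.
  exact: scalar_bias_le.
(* Writing [r^2] as the sum that determines [lam] reduces the bound to the scalar identity in each
   coordinate. *)
rewrite lee_fin (le_trans (lerD bias (lexx _)))// -lamr !mulr_sumr -big_split/=.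
rewrite le_eqVlt; apply/orP; left; apply/eqP; apply: eq_bigr => i _.
by rewrite -(scalar_minimax_risk lam0 (e0 i)) mxE; ring.
Qed.

End MinimaxBounds.

(** * Specialization to the source and target covariances *)

Theorem theorem1 (R : realType) (d nS : nat) (sigma r : R)
  (XS : 'M[R]_(nS, d)) (SigmaT ST12 U : 'M[R]_d) (t s : 'rV[R]_d) (lambda : R) :
  (0 < d)%N -> (0 < nS)%N -> 0 < sigma -> 0 < r ->
  let SigmaS := nS%:R^-1 *: (XS^T *m XS) in
  SigmaS \in unitmx ->
  (* Sigma_T positive definite *)
  SigmaT^T = SigmaT ->
  (forall x : 'cV[R]_d, x != 0 -> 0 < (x^T *m SigmaT *m x) 0 0) ->
  (* ST12 = Sigma_T^{1/2}, the positive semidefinite square root *)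
  ST12^T = ST12 ->
  (forall x : 'cV[R]_d, 0 <= (x^T *m ST12 *m x) 0 0) ->
  ST12 *m ST12 = SigmaT ->
  (* common orthogonal diagonalization *)
  U^T *m U = 1%:M -> U *m U^T = 1%:M ->
  (forall i, 0 < t 0 i) -> (forall i, 0 < s 0 i) ->
  SigmaT = U *m diag_mx t *m U^T ->
  SigmaS = U *m diag_mx s *m U^T ->
  (* lambda = lambda(r) *)
  0 < lambda ->
  sigma ^+ 2 / nS%:R * \sum_(i < d) (s 0 i)^-1 * pos (Num.sqrt (t 0 i) / lambda - 1)
    = r ^+ 2 ->
  let value := \sum_(i < d) sigma ^+ 2 / nS%:R * (t 0 i / s 0 i)
                 * pos (1 - lambda / Num.sqrt (t 0 i)) in
  let A_SS := nS%:R^-1 *: (invmx SigmaS *m XS^T) in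
  let A_MM := invmx ST12 *m U
                *m diag_mx (\row_i pos (1 - lambda / Num.sqrt (t 0 i)))
                *m U^T *m ST12 *m A_SS in
  (forall A : 'M[R]_(d, nS), (value%:E <= max_risk sigma r XS ST12 A)%E) /\
  max_risk sigma r XS ST12 A_MM = value%:E.
Proof.
move=> d0 n0 sg0 r0 SigmaS SigmaSu _ _ _ psd SS UtU UUt t0 s0 STE SSE lam0 lamr.
move=> value A_SS A_MM.
have n0R : 0 < nS%:R :> R by rewrite ltr0n.
have nz : nS%:R != 0 :> R by rewrite gt_eqF.
have sgz : sigma != 0 by rewrite gt_eqF.
pose e : 'rV[R]_d := \row_i Num.sqrt (t 0 i).
have eE i : e 0 i = Num.sqrt (t 0 i) by rewrite mxE.
have e0 i : 0 < e 0 i by rewrite eE sqrtr_gt0.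
have e2 i : e 0 i ^+ 2 = t 0 i by rewrite eE sqr_sqrtr// ltW.
(* The eigenvalues of [XS^T *m XS], which is [nS] times [SigmaS]. *)
pose s' : 'rV[R]_d := \row_i (nS%:R * s 0 i).
have s'E i : s' 0 i = nS%:R * s 0 i by rewrite mxE.
have s'0 i : 0 < s' 0 i by rewrite s'E mulr_gt0.
(* In the basis [U], [ST12] becomes a positive semidefinite root of [diag_mx t], hence equals
   [diag_mx e]. *)
have STE12 : ST12 = U *m diag_mx e *m U^T.
  rewrite -(@psd_sqrt_diag_mx R d (U^T *m ST12 *m U) t)//.
  - by rewrite !mulmxA UUt mul1mx -mulmxA UUt mulmx1.
  - by move=> x; have := psd (U *m x); rewrite trmx_mul !mulmxA.
  - rewrite !mulmxA -(mulmxA _ U U^T) UUt mulmx1 -(mulmxA _ ST12 ST12) SS STE.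
    by rewrite !mulmxA UtU mul1mx -mulmxA UtU mulmx1.
have XX : XS^T *m XS = U *m diag_mx s' *m U^T.
  have -> : diag_mx s' = nS%:R *: diag_mx s.
    by rewrite -linearZ/=; congr diag_mx; apply/rowP => i; rewrite !mxE.
  by rewrite -scalemxAr -scalemxAl -SSE scalerA divff// scale1r.
have lamr' : \sum_i sigma ^+ 2 / s' 0 i * pos (e 0 i / lambda - 1) = r ^+ 2.
  rewrite -lamr mulr_sumr; apply: eq_bigr => i _; rewrite s'E eE.
  by rewrite invfM !mulrA.
have valueE : value =
    \sum_i sigma ^+ 2 / s' 0 i * (e 0 i ^+ 2 * pos (1 - lambda / e 0 i)).
  apply: eq_bigr => i _; rewrite e2 eE s'E; set c := pos _; field.
  by rewrite nz gt_eqF.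
have lower A : (value%:E <= max_risk sigma r XS ST12 A)%E.
  by rewrite valueE STE12; exact: minimax_lower_bound.
(* The lower bound at [A_MM] is one half of the equality; the upper bound remains. *)
split=> //; apply/eqP; rewrite eq_le lower andbT valueE.
have AX : A_SS *m XS = 1%:M.
  by rewrite /A_SS -scalemxAl -mulmxA scalemxAr mulVmx.
have -> : A_MM = invmx ST12 *m U *m diag_mx (\row_i pos (1 - lambda / e 0 i))
    *m U^T *m ST12 *m A_SS.
  rewrite /A_MM; congr (_ *m diag_mx _ *m _ *m _ *m _).
  by apply/rowP => i; rewrite !mxE.
apply: minimax_upper_bound => //.
have SigmaST : SigmaS^T = SigmaS.
  by rewrite /SigmaS linearZ/= trmx_mul trmxK.
(* Up to the factor [sigma^2], this is the covariance of the least-squares estimator. *)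
have -> : A_SS *m A_SS^T = nS%:R^-1 *: invmx SigmaS.
  rewrite {2}/A_SS linearZ/= trmx_mul trmxK trmx_inv SigmaST -scalemxAr.
  by rewrite mulmxA AX mul1mx.
rewrite -scalemxAr -scalemxAl.
have -> : U^T *m invmx SigmaS *m U = diag_mx (\row_i (s 0 i)^-1).
  (* A left inverse ([Dinv]) and a right inverse ([DK]) of [diag_mx s] coincide. *)
  have Dinv : diag_mx (\row_i (s 0 i)^-1) *m diag_mx s = 1%:M.
    rewrite mulmx_diag -diag_const_mx; congr diag_mx; apply/rowP => i.
    by rewrite !mxE mulVf// gt_eqF.
  have DK : diag_mx s *m (U^T *m invmx SigmaS *m U) = 1%:M.
    have -> : diag_mx s = U^T *m SigmaS *m U.
      by rewrite SSE !mulmxA UtU mul1mx -mulmxA UtU mulmx1.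
    rewrite !mulmxA -(mulmxA _ U U^T) UUt mulmx1 -(mulmxA _ SigmaS) mulmxV//.
    by rewrite mulmx1.
  by rewrite -[LHS]mul1mx -Dinv -(mulmxA _ (diag_mx s)) DK mulmx1.
rewrite -linearZ/=; congr diag_mx; apply/rowP => i; rewrite !mxE.
by rewrite invfM.
Qed.
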